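(* Let $v_1,\ldots,v_m\in\mathbb{C}^n$ be vectors with $\sum_{i=1}^m v_iv_i^*=I_n$. Then for every integer $k$ with $1\le k<n$ there is a subset $S\subset\{1,\ldots,m\}$ of size $k$ such that $$\lambda_k\left(\sum_{i\in S}v_iv_i^*\right)\ge\left(1-\sqrt{\frac{k}{n}}\right)^2\frac{n}{m}.$$
   Context: For an $n\times n$ Hermitian matrix, $\lambda_1\ge\lambda_2\ge\cdots\ge\lambda_n$ denote its eigenvalues counted with multiplicity, so $\lambda_k$ is the $k$-th largest eigenvalue. $v^*$ denotes the conjugate transpose of $v$. *)

(* Defs.v *)
From mathcomp Require Export all_boot all_order all_algebra.
From mathcomp Require Export reals complex.

Set Implicit Arguments.
Unset Strict Implicit.
Unset Printing Implicit Defensive.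

Import Order.TTheory GRing.Theory Num.Theory.
Local Open Scope ring_scope.
Local Open Scope complex_scope.
Local Open Scope sesquilinear_scope.

Section Eigenvalues.
Variables (R : realType) (n : nat).
Implicit Type A : 'M[R[i]]_n.

(* The roots of the characteristic polynomial, with multiplicity. *)
Definition complex_eigenvalues A : seq R[i] :=
  sval (closed_field_poly_normal (char_poly A)).

(* For Hermitian A the roots are real, so taking real parts loses nothing:
   see char_poly_hermitian below. *)
Definition eigenvalues A : seq R :=
  sort >=%R [seq complex.Re z | z <- complex_eigenvalues A].

(* The index k is 1-based: lambda_ 1 A is the largest eigenvalue.  The value is
   meaningful for Hermitian A and 1 <= k <= n only. *)
Definition lambda_ (k : nat) A : R := (eigenvalues A)`_k.-1.

Lemma char_poly_complex_eigenvalues A :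
  char_poly A = \prod_(z <- complex_eigenvalues A) ('X - z%:P).
Proof.
rewrite /complex_eigenvalues; case: closed_field_poly_normal => r /= {1}->.
by rewrite (monicP (char_poly_monic A)) scale1r.
Qed.

Lemma size_eigenvalues A : size (eigenvalues A) = n.
Proof.
have := size_char_poly A; rewrite char_poly_complex_eigenvalues.
by rewrite size_prod_XsubC size_sort size_map => -[].
Qed.

Lemma eigenvalues_sorted A : sorted >=%R (eigenvalues A).
Proof. by apply: sort_sorted => x y; exact: le_total. Qed.

Lemma complex_eigenvalues_real A : A^t* = A ->
  {in complex_eigenvalues A, forall z, (complex.Re z)%:C = z}.
Proof.
move=> hA z zA; have: root (char_poly A) z.
  by rewrite char_poly_complex_eigenvalues root_prod_XsubC.
rewrite -eigenvalue_root_char => /eigenvalueP[u uA u0].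
have e1 : z *: (u *m u^t*) = Num.conj z *: (u *m u^t*).
  have -> : z *: (u *m u^t*) = u *m A *m u^t* by rewrite uA scalemxAl.
  rewrite -mulmxA scalemxAr; congr (_ *m _).
  have := congr1 (fun w : 'rV_n => w^t*) uA.
  rewrite trmx_mul map_mxM hA => ->.
  by apply/matrixP => i j; rewrite !mxE rmorphM.
have: (u *m u^t*) 0 0 != 0.
  apply: contra_neq u0; rewrite mxE => /eqP.
  rewrite psumr_eq0 => [/allP h|j _]; last by rewrite !mxE mul_conjC_ge0.
  apply/rowP => j; have := h j (mem_index_enum _).
  by rewrite !mxE mul_conjC_eq0 => /eqP.
move=> u1; have /matrixP/(_ 0 0) := e1.
rewrite [LHS]mxE [RHS]mxE => /(mulIf u1) zJ.
by apply: RRe_real; apply/CrealP.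
Qed.

Lemma char_poly_hermitian A : A^t* = A ->
  char_poly A = \prod_(x <- eigenvalues A) ('X - x%:C%:P).
Proof.
move=> hA; rewrite /eigenvalues (perm_big _ (permEl (perm_sort _ _))) big_map.
rewrite char_poly_complex_eigenvalues; apply: eq_big_seq => z zA /=.
by rewrite (complex_eigenvalues_real hA zA).
Qed.

End Eigenvalues.

(* Main.v *)
Require Import Defs.
From mathcomp Require Import ring.

(** The vectors are chosen one at a time by a greedy argument driven by a
    barrier (after Spielman and Srivastava).

    Let V be the n x l matrix whose columns are the vectors chosen so far, so
    that V V^* is the sum of their rank-one matrices.  Two things are maintained
    for a barrier b that decreases from step to step:
    - V^* V - b is positive definite, that is, V V^* has l eigenvalues above b,
      all the others being 0 ([gram_gt V b]);
    - the potential tr (V V^* - b)^-1 ([barrier V b]) is at most - m - 1/e,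
      where e is the amount by which b decreases at each step.

    When w is added, the matrix determinant lemma and the Sherman-Morrison
    formula express everything through R = (V V^* - c)^-1, where c = b - e.
    By a Schur complement, V^* V - c stays positive definite for the enlarged
    matrix as soon as 1 + w^* R w < 0 ([gram_gt_row_mx]).  The potential at c
    changes by - w^* R^2 w / (1 + w^* R w) ([sherman_morrison_trace]).  So w is
    good when
      w^* R^2 w <= D * - (1 + w^* R w),
    where D > 0 is the drop of the potential of V when the barrier moves from b
    to c.  Summed over all m vectors, which form a decomposition of the
    identity, this inequality becomes tr R^2 <= D * (- m - tr R).  It holds because
    tr R^2 <= D / e + D^2, a statement on real numbers about the eigenvalues of
    V V^* ([barrier_shift]), and because of the bound on the potential.  Hence
    some v_i is good ([barrier_step]).

    With s = sqrt (k / n), the choice b = (1 - s) n / m and e = (1 - s) / (s m)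
    satisfies the bound on the potential at the start (with equality), and after
    k steps the barrier is at b - k e = (1 - s)^2 n / m.  This is positive, so
    the k chosen vectors are linearly independent, hence distinct, and the k-th
    largest eigenvalue of the sum of their rank-one matrices is above the final
    barrier ([lambda_gram]). *)

Set Implicit Arguments.
Unset Strict Implicit.
Unset Printing Implicit Defensive.

Import Order.TTheory GRing.Theory Num.Theory.
Local Open Scope ring_scope.
Local Open Scope sesquilinear_scope.

(** * Diagonal matrices, resolvents and rank-one updates *)

(** Rank counts the nonzero entries: cutting [diag_mx d] down to those
    entries is a two-sided multiplication, as is padding it back. *)
Lemma mxrank_diag (F : fieldType) n (d : 'rV[F]_n) :
  \rank (diag_mx d) = #|[pred j | d 0 j != 0]|.
Proof.
set Z := [pred j | _].
pose E : 'M[F]_(#|Z|, n) := \matrix_(i, j) (enum_val i == j)%:R.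
pose e : 'rV[F]_#|Z| := \row_i d 0 (enum_val i).
have EdE : E *m diag_mx d *m E^T = diag_mx e.
  rewrite mul_mx_diag; apply/matrixP => i j; rewrite !mxE.
  rewrite (bigD1 (enum_val i)) //= big1 => [|k /negPf ki]; last first.
    by rewrite !mxE eq_sym ki !mul0r.
  by rewrite !mxE eqxx mul1r addr0 (inj_eq enum_val_inj) eq_sym mulr_natr.
have EeE : E^T *m diag_mx e *m E = diag_mx d.
  rewrite mul_mx_diag; apply/matrixP => i j; rewrite !mxE.
  have [Zi|nZi] := boolP (i \in Z).
    rewrite (bigD1 (enum_rank_in Zi i)) //= big1 => [|k]; last first.
      rewrite -(inj_eq enum_val_inj) enum_rankK_in // !mxE => /negPf->.
      by rewrite !mul0r.
    by rewrite !mxE enum_rankK_in // eqxx mul1r addr0 mulr_natr.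
  rewrite big1 => [|k _]; last first.
    rewrite !mxE; case: eqP => [ik|]; last by rewrite !mul0r.
    by rewrite -ik enum_valP in nZi.
  by move: nZi; rewrite inE negbK => /eqP->; rewrite mul0rn.
have eu : diag_mx e \in unitmx.
  rewrite unitmxE det_diag unitfE prodf_seq_neq0; apply/allP => i _ /=.
  by rewrite mxE; have := enum_valP i.
apply/eqP; rewrite eqn_leq; apply/andP; split.
  rewrite -EeE (leq_trans (mxrankM_maxl _ _)) //.
  by rewrite (leq_trans (mxrankM_maxr _ _)) // mxrank_unit.
rewrite -{1}(mxrank_unit eu) -EdE (leq_trans (mxrankM_maxl _ _)) //.
exact: mxrankM_maxr.
Qed.

Section Resolvent.
Variables (F : fieldType) (n : nat) (P : 'M[F]_n) (d : 'rV[F]_n).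
Hypothesis Pu : P \in unitmx.
Let A := invmx P *m diag_mx d *m P.

Lemma conj_diag_mul (e f : 'rV[F]_n) :
  (invmx P *m diag_mx e *m P) *m (invmx P *m diag_mx f *m P) =
  invmx P *m diag_mx (\row_j (e 0 j * f 0 j)) *m P.
Proof.
by rewrite !mulmxA mulmxK // -(mulmxA _ (diag_mx e)) mulmx_diag.
Qed.

Lemma mxtrace_conj_diag (e : 'rV[F]_n) :
  \tr (invmx P *m diag_mx e *m P) = \sum_j e 0 j.
Proof. by rewrite mxtrace_mulC mulmxA mulmxV // mul1mx mxtrace_diag. Qed.

Lemma resolvent_conj_diag (b : F) : (forall j, d 0 j != b) ->
  A - b%:M \in unitmx /\
  invmx (A - b%:M) = invmx P *m diag_mx (\row_j (d 0 j - b)^-1) *m P.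
Proof.
move=> db.
have Ab : A - b%:M = invmx P *m diag_mx (\row_j (d 0 j - b)) *m P.
  have -> : diag_mx (\row_j (d 0 j - b)) = diag_mx d - b%:M.
    apply/matrixP => i j; rewrite !mxE.
    by case: eqP => [->|]; rewrite ?mulr1n ?mulr0n ?subr0.
  rewrite mulmxBr mulmxBl; congr (_ - _).
  by rewrite -mulmxA mul_scalar_mx -scalemxAr mulVmx // scalemx1.
have inv :
    (A - b%:M) *m (invmx P *m diag_mx (\row_j (d 0 j - b)^-1) *m P) = 1%:M.
  rewrite Ab conj_diag_mul -[RHS](mulVmx Pu) -[in RHS](mulmx1 (invmx P)).
  congr (_ *m _ *m _); rewrite -diag_const_mx; congr diag_mx.
  by apply/rowP => j; rewrite !mxE divff // subr_eq0.
have [Abu _] := mulmx1_unit inv; split=> //.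
by rewrite -[LHS]mulmx1 -inv mulKmx.
Qed.

End Resolvent.

(** The Sherman-Morrison formula for the inverse of a rank-one update, after
    taking traces. *)
Lemma sherman_morrison_trace (F : fieldType) n (B : 'M[F]_n) (u : 'cV[F]_n)
    (v : 'rV[F]_n) :
  B \in unitmx -> 1 + (v *m invmx B *m u) 0 0 != 0 ->
  \tr (invmx (B + u *m v)) =
  \tr (invmx B) -
    (v *m invmx B *m invmx B *m u) 0 0 / (1 + (v *m invmx B *m u) 0 0).
Proof.
move=> Bu; set q := (v *m invmx B *m u) 0 0 => q0.
have vBu : v *m invmx B *m u = q%:M by rewrite [LHS]mx11_scalar.
have inv : (B + u *m v) *m
    (invmx B - (1 + q)^-1 *: (invmx B *m u *m (v *m invmx B))) = 1%:M.
  rewrite mulmxBr mulmxDl mulmxV // -scalemxAr mulmxDl !mulmxA mulmxV // mul1mx.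
  rewrite -(mulmxA (u *m v)) -(mulmxA u v) (mulmxA v) vBu.
  rewrite mul_mx_scalar -!scalemxAl -[X in X + q *: _]scale1r -scalerDl scalerA.
  by rewrite mulVf // scale1r addrK.
have [Bu' _] := mulmx1_unit inv.
have -> : invmx (B + u *m v) =
    invmx B - (1 + q)^-1 *: (invmx B *m u *m (v *m invmx B)).
  by rewrite -[LHS]mulmx1 -inv mulKmx.
rewrite linearB linearZ /= (mxtrace_mulC (_ *m u)) !mulmxA trace_mx11.
by rewrite mulrC.
Qed.

(** * Conjugate transposes and Hermitian matrices *)

Section LinearAlgebra.
Variable C : numClosedFieldType.

Lemma trmxC_mul m n p (A : 'M[C]_(m, n)) (B : 'M[C]_(n, p)) :
  (A *m B)^t* = B^t* *m A^t*.
Proof. by rewrite trmx_mul map_mxM. Qed.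

Lemma trmxCD m n (A B : 'M[C]_(m, n)) : (A + B)^t* = A^t* + B^t*.
Proof. by rewrite linearD /= map_mxD. Qed.

Lemma trmxC_scalar n (a : C) : a \is Num.real -> (a%:M : 'M_n)^t* = a%:M.
Proof. by move=> /CrealP ar; rewrite tr_scalar_mx map_scalar_mx /= ar. Qed.

Definition sqnorm n (x : 'cV[C]_n) : C := (x^t* *m x) 0 0.

Lemma sqnormE n (x : 'cV[C]_n) : sqnorm x = \sum_i `|x i 0| ^+ 2.
Proof.
by rewrite /sqnorm mxE; apply: eq_bigr => i _; rewrite !mxE normCK mulrC.
Qed.

Lemma sqnorm_ge0 n (x : 'cV[C]_n) : 0 <= sqnorm x.
Proof. by rewrite sqnormE sumr_ge0 // => i _; rewrite exprn_ge0. Qed.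

Lemma sqnorm_eq0 n (x : 'cV[C]_n) : (sqnorm x == 0) = (x == 0).
Proof.
apply/eqP/eqP => [|->]; last by rewrite /sqnorm mulmx0 mxE.
rewrite sqnormE => /eqP; rewrite psumr_eq0 => [/allP h|i _]; last first.
  by rewrite exprn_ge0.
apply/colP => i; have := h i (mem_index_enum _).
by rewrite mxE /= sqrf_eq0 normr_eq0 => /eqP.
Qed.

Lemma sqnorm_gt0 n (x : 'cV[C]_n) : (0 < sqnorm x) = (x != 0).
Proof. by rewrite lt_def sqnorm_ge0 andbT sqnorm_eq0. Qed.

Lemma hermitian_form_real n (X : 'M[C]_n) (w : 'cV[C]_n) :
  X^t* = X -> (w^t* *m X *m w) 0 0 \is Num.real.
Proof.
move=> hX; apply/CrealP.
have {2}-> : w^t* *m X *m w = (w^t* *m X *m w)^t*.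
  by rewrite !trmxC_mul trmxCK hX mulmxA.
by rewrite [in RHS]mxE [in RHS]mxE.
Qed.

Lemma trmxC_inv n (A : 'M[C]_n) : A^t* = A -> (invmx A)^t* = invmx A.
Proof. by move=> hA; rewrite trmx_inv map_invmx hA. Qed.

Lemma gram_hermitian n l (V : 'M[C]_(n, l)) : (V *m V^t*)^t* = V *m V^t*.
Proof. by rewrite trmxC_mul trmxCK. Qed.

Lemma hermitian_diagonalization n (A : 'M[C]_n) : A^t* = A ->
  exists2 P : 'M_n, P \in unitmx & exists d, A = invmx P *m diag_mx d *m P.
Proof.
move=> hA; have An : A \is normalmx by apply/normalmxP; rewrite hA.
exists (spectralmx A); first exact: spectral_unit.
by exists (spectral_diag A); apply/orthomx_spectralP.
Qed.

End LinearAlgebra.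

(** * Gram matrices bounded below *)

Section Gram.
Variable C : numClosedFieldType.

(** Positive definiteness of [V^* V - b].  The Gram matrix [V^* V] has the same
    nonzero eigenvalues as [V V^*], but it is for this form that adding a column
    is easy. *)
Definition gram_gt n l (V : 'M[C]_(n, l)) (b : C) :=
  forall x : 'cV_l, x != 0 -> b * sqnorm x < sqnorm (V *m x).

Lemma gram_gt_le n l (V : 'M[C]_(n, l)) (a b : C) :
  a <= b -> gram_gt V b -> gram_gt V a.
Proof.
move=> ab Vb x x0; apply: le_lt_trans (Vb x x0).
by rewrite ler_wpM2r ?sqnorm_ge0.
Qed.

Lemma mxrank_gram n l (V : 'M[C]_(n, l)) (b : C) :
  0 <= b -> gram_gt V b -> \rank (V *m V^t*) = l.
Proof.
move=> b0 Vb; have Vfree : row_free (V^t*).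
  apply: inj_row_free => y yV; apply/eqP; apply: contraT => y0.
  have yt0 : y^t* != 0.
    by apply: contra_neq y0 => yt; rewrite -[y]trmxCK yt trmx0 map_mx0.
  have := Vb _ yt0; have -> : V *m y^t* = 0.
    by rewrite -[V]trmxCK -trmxC_mul yV trmx0 map_mx0.
  have -> : sqnorm (0 : 'cV[C]_n) = 0 by apply/eqP; rewrite sqnorm_eq0.
  by rewrite le_gtF // mulr_ge0 // sqnorm_ge0.
by rewrite mxrankMfree // -mxrank_tr -(mxrank_map Num.conj) (eqP Vfree).
Qed.

(** If [u] is an eigenvector of [V V^*] then [V^* u] is either 0 or an
    eigenvector of [V^* V] for the same eigenvalue. *)
Lemma gram_eigenvalue n l (V : 'M[C]_(n, l)) (b : C) (u : 'cV_n) (a : C) :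
  gram_gt V b -> u != 0 -> V *m V^t* *m u = a *: u -> a = 0 \/ b < a.
Proof.
move=> Vb u0 Vu; have [x0|x0] := eqVneq (V^t* *m u) 0; [left|right].
  move: Vu; rewrite -mulmxA x0 mulmx0 => /esym/eqP.
  by rewrite scaler_eq0 (negPf u0) orbF => /eqP.
move: (Vb _ x0); have -> : sqnorm (V *m (V^t* *m u)) = a * sqnorm (V^t* *m u).
  rewrite /sqnorm trmxC_mul -!mulmxA (mulmxA V) Vu.
  by rewrite -!scalemxAr mxE.
by rewrite ltr_pM2r // sqnorm_gt0.
Qed.

(** The potential depends on [V] only through this spectral picture: [l]
    eigenvalues above [b] and [n - l] zeros. *)
Lemma gram_spectrum n l (V : 'M[C]_(n, l)) (b : C) : 0 <= b -> gram_gt V b ->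
  exists2 P : 'M[C]_n, P \in unitmx &
  exists d, [/\ V *m V^t* = invmx P *m diag_mx d *m P,
                forall j, d 0 j = 0 \/ b < d 0 j &
                #|[pred j | d 0 j != 0]| = l].
Proof.
move=> b0 Vb.
have [P Pu [d Ad]] := hermitian_diagonalization (gram_hermitian V).
exists P => //; exists d; split=> // [j|]; last first.
  rewrite -mxrank_diag -(mxrank_gram b0 Vb) Ad mxrankMfree ?row_free_unit //.
  by rewrite eqmxMfull // row_full_unit unitmx_inv.
apply: (@gram_eigenvalue n l V b (col j (invmx P))) => //.
  apply/eqP => /(congr1 (mulmx P)).
  rewrite colE mulmxA mulmxV // mul1mx mulmx0 => /colP/(_ j)/eqP.
  by rewrite !mxE eqxx oner_eq0.
rewrite Ad colE mulmxA mulmxK // -!colE mul_mx_diag; apply/colP => i.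
by rewrite !mxE mulrC.
Qed.

Lemma sqnormDZ n (x r : 'cV[C]_n) (a : C) :
  sqnorm (x + a *: r) = sqnorm x + a * (x^t* *m r) 0 0
    + a^* * (r^t* *m x) 0 0 + a * a^* * sqnorm r.
Proof.
rewrite /sqnorm trmxCD linearZ /= map_mxZ.
rewrite mulmxDl !mulmxDr -!scalemxAl -!scalemxAr !mxE; ring.
Qed.

Lemma sqnorm_col_mx n p (x : 'cV[C]_n) (y : 'cV[C]_p) :
  sqnorm (col_mx x y) = sqnorm x + sqnorm y.
Proof. by rewrite /sqnorm tr_col_mx map_row_mx mul_row_col mxE. Qed.

(** Positive definiteness survives the addition of the column [w] exactly when
    the Schur complement of the old block is positive, and that complement is
    [- b (1 + w^* B^-1 w)].  The proof completes the square: with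
    [t = V^* B^-1 w] and [z = (y, x)], the form at [z] is the old form at
    [x + y t] plus [- b (1 + w^* B^-1 w) |y|^2]. *)
Lemma gram_gt_row_mx n l (V : 'M[C]_(n, l)) (w : 'cV[C]_n) (b : C) :
  let B := V *m V^t* - b%:M in
  0 < b -> gram_gt V b -> B \in unitmx ->
  1 + (w^t* *m invmx B *m w) 0 0 < 0 -> gram_gt (row_mx w V) b.
Proof.
move=> B b0 Vb Bu q0 z z0.
(* t solves (V^* V - b) t = V^* w; with B, no inverse of V^* V - b is needed. *)
pose g := invmx B *m w; pose t := V^t* *m g.
have Bg : V *m t = w + b *: g.
  rewrite mulmxA -[V *m V^t*](subrK (b%:M)) -/B mulmxDl mul_scalar_mx.
  by rewrite mulKVmx.
have bR : b^* = b by apply/CrealP; exact: gtr0_real.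
have qE : (w^t* *m invmx B *m w) 0 0 = sqnorm t - b * sqnorm g.
  have wJ : w^t* = t^t* *m V^t* - b *: g^t*.
    have {1}-> : w = V *m t + (- b) *: g by rewrite Bg scaleNr addrK.
    by rewrite trmxCD linearZ /= map_mxZ rmorphN /= bR scaleNr trmxC_mul.
  by rewrite -mulmxA -/g wJ mulmxBl -mulmxA -scalemxAl -/t /sqnorm !mxE.
pose y := z 0 0; pose x : 'cV[C]_l := dsubmx z; pose s := x + y *: t.
have zE : z = col_mx y%:M x.
  by rewrite -[z]vsubmxK; congr col_mx; rewrite [LHS]mx11_scalar mxE lshift0.
have VzE : row_mx w V *m z = V *m s - (y * b) *: g.
  rewrite zE mul_row_col mulmxDr -scalemxAr Bg scalerDr scalerA addrA addrK.
  by rewrite mul_mx_scalar addrC.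
have zN : sqnorm z = y * y^* + sqnorm (s - y *: t).
  rewrite zE sqnorm_col_mx /s addrK; congr (_ + _).
  by rewrite sqnormE big_ord1 !mxE eqxx normCK.
have Vst : ((V *m s)^t* *m g) 0 0 = (s^t* *m t) 0 0.
  by rewrite trmxC_mul -mulmxA.
have tVs : (g^t* *m (V *m s)) 0 0 = (t^t* *m s) 0 0.
  by rewrite /t trmxC_mul trmxCK mulmxA.
have defect : sqnorm (row_mx w V *m z) - b * sqnorm z =
    (sqnorm (V *m s) - b * sqnorm s)
      + b * (y * y^*) * (- (1 + (w^t* *m invmx B *m w) 0 0)).
  rewrite VzE zN qE -!scaleNr !sqnormDZ Vst tVs !rmorphN /= rmorphM /= bR; ring.
rewrite -subr_gt0 defect; have [s0|s0] := eqVneq s 0; last first.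
  rewrite ltr_wpDr ?subr_gt0 ?Vb //.
  rewrite -mulrA mulr_ge0 ?(ltW b0) // mulr_ge0 ?mul_conjC_ge0 //.
  by rewrite oppr_ge0 ltW.
have y0 : y != 0.
  apply: contra_neq z0 => y0; move: s0; rewrite /s y0 scale0r addr0 => x0.
  by rewrite zE y0 x0 raddf0 col_mx0.
have -> : sqnorm (V *m s) - b * sqnorm s = 0.
  by rewrite s0 mulmx0 /sqnorm !mulmx0 !mxE mulr0 subr0.
by rewrite add0r -mulrA mulr_gt0 // mulr_gt0 ?mul_conjC_gt0 ?oppr_gt0.
Qed.

End Gram.

(** * One step of the barrier argument *)

Section Barrier.

(** Here [d] lists the eigenvalues of [V V^*] and [D] is the drop of the
    potential.  Each term of [D / (b - c)] is [p = 1 / ((d - b) (d - c))].  When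
    [d > b] it dominates [1 / (d - c)^2].  When [d = 0] it falls short by
    [(b - c) / (b c^2)], and the term [D ^+ 2] makes up for the sum of these
    deficits as soon as there are at least [b / (b - c)] zeros. *)
Lemma barrier_shift (F : numFieldType) n (d : 'I_n -> F) (b c : F) :
  (0 < n)%N -> 0 < c < b -> (forall j, d j = 0 \/ b < d j) ->
  b <= #|[pred j | d j == 0]|%:R * (b - c) ->
  let D := \sum_j (d j - b)^-1 - \sum_j (d j - c)^-1 in
  0 < D /\ \sum_j (d j - c)^-1 ^+ 2 <= D / (b - c) + D ^+ 2.
Proof.
move=> n0 /andP[c0 cb] hd hZ D; have b0 : 0 < b by apply: lt_trans cb.
have bc0 : 0 < b - c by rewrite subr_gt0.
pose p j := ((d j - b) * (d j - c))^-1.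
have p0 j : 0 < p j.
  rewrite invr_gt0; case: (hd j) => [->|dj].
    by rewrite !sub0r mulrNN mulr_gt0.
  by rewrite mulr_gt0 // subr_gt0 // (lt_trans cb).
have db j : d j - b != 0.
  by rewrite subr_eq0; case: (hd j) => [->|/gt_eqF->//]; rewrite eq_sym gt_eqF.
have dc j : d j - c != 0.
  rewrite subr_eq0; case: (hd j) => [->|]; first by rewrite eq_sym gt_eqF.
  by move=> /(lt_trans cb)/gt_eqF->.
have DE : D = (b - c) * \sum_j p j.
  rewrite /D -sumrB mulr_sumr; apply: eq_bigr => j _; rewrite /p; field.
  by rewrite db dc.
have D0 : 0 < D.
  rewrite DE mulr_gt0 // lt_def sumr_ge0 ?andbT => [|j _]; last exact: ltW.
  rewrite psumr_neq0 => [|j _]; last exact: ltW.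
  by apply/hasP; exists (Ordinal n0); rewrite ?mem_index_enum ?p0.
split=> //.
set x := #|_|%:R * (b - c) in hZ.
have xE (y : F) : \sum_j (d j == 0)%:R * y = #|[pred j | d j == 0]|%:R * y.
  rewrite -mulr_suml; congr (_ * _); rewrite -natr_sum -sum1_card.
  by rewrite [in RHS]big_mkcond.
have Dx : x / (b * c) <= D.
  rewrite DE mulr_sumr /x -mulrA -xE; apply: ler_sum => j _.
  have [d0|_] := eqVneq (d j) 0; last by rewrite mul0r mulr_ge0 ?ltW.
  by rewrite mul1r /p d0 !sub0r mulrNN.
have Qp : \sum_j (d j - c)^-1 ^+ 2 <= \sum_j p j + x / (b * c ^+ 2).
  rewrite /x -mulrA -xE -big_split; apply: ler_sum => j _ /=.
  have [d0|dj0] := eqVneq (d j) 0.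
    rewrite mul1r /p d0 le_eqVlt; apply/orP; left; apply/eqP; field.
    by rewrite !gt_eqF.
  have bd : b < d j by case: (hd j) => // dj; rewrite dj eqxx in dj0.
  have cd := lt_trans cb bd.
  rewrite mul0r addr0 /p exprVn.
  rewrite lef_pV2 ?posrE ?mulr_gt0 ?exprn_gt0 ?subr_gt0 //.
  by rewrite expr2 ler_pM2r ?subr_gt0 // lerD2l lerN2 ltW.
apply: le_trans Qp _; rewrite DE [(b - c) * _]mulrC mulfK ?gt_eqF // lerD2l.
rewrite mulrC -DE; have x0 : 0 < x by apply: lt_le_trans hZ.
apply: le_trans (_ : (x / (b * c)) ^+ 2 <= _); last first.
  by rewrite lerXn2r ?nnegrE // ?divr_ge0 ?mulr_ge0 // ltW.
have -> : (x / (b * c)) ^+ 2 = x / (b * c ^+ 2) * (x / b).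
  by field; rewrite !gt_eqF.
apply: ler_peMr; last by rewrite ler_pdivlMr // mul1r.
by rewrite ltW // divr_gt0 // mulr_gt0 // exprn_gt0.
Qed.

Variable C : numClosedFieldType.
Variables (n m : nat) (v : 'I_m -> 'cV[C]_n).
Hypothesis hv : \sum_(i < m) v i *m (v i)^t* = 1%:M.

Lemma isotropic_trace (X : 'M[C]_n) :
  \sum_i ((v i)^t* *m X *m v i) 0 0 = \tr X.
Proof.
rewrite -[in RHS](mulmx1 X) -hv mulmx_sumr raddf_sum; apply: eq_bigr => i _ /=.
by rewrite -trace_mx11 -mulmxA mxtrace_mulC mulmxA.
Qed.

Definition barrier l (V : 'M[C]_(n, l)) (b : C) :=
  \tr (invmx (V *m V^t* - b%:M)).

(** A column that moves the barrier from [b] to [c] without raising the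
    potential is found by averaging over the [v i]. *)
Lemma barrier_step l (V : 'M[C]_(n, l)) (b c : C) :
  0 < c < b -> gram_gt V b -> b <= (n - l)%:R * (b - c) ->
  barrier V b <= - m%:R - (b - c)^-1 ->
  exists i, gram_gt (row_mx (v i) V) c /\
    barrier (row_mx (v i) V) c <= barrier V b.
Proof.
move=> cb Vb hb; have /andP[c0 cb'] := cb.
have b0 : 0 < b by apply: lt_trans cb'.
have bc0 : 0 < b - c by rewrite subr_gt0.
have n0 : (0 < n)%N.
  case: (n) hb => //; rewrite sub0n mul0r => /(lt_le_trans b0).
  by rewrite ltxx.
have m0 : (0 < m)%N.
  move: hv; case: (m) v => // v0; rewrite big_ord0.
  move=> /matrixP/(_ (Ordinal n0) (Ordinal n0))/eqP.
  by rewrite !mxE eqxx eq_sym oner_eq0.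
have [P Pu [d [Ad hd Zd]]] := gram_spectrum (ltW b0) Vb.
have hd0 (a : C) : 0 < a <= b -> forall j, d 0 j != a.
  move=> /andP[a0 ab] j; case: (hd j) => [->|bd]; first by rewrite lt_eqF.
  by rewrite gt_eqF // (le_lt_trans ab).
have [|_ Rb] := resolvent_conj_diag Pu (hd0 b _); first by rewrite b0 lexx.
have [|Bu Rc] := resolvent_conj_diag Pu (hd0 c _); first by rewrite c0 ltW.
rewrite -Ad in Rb Rc Bu.
set B := V *m V^t* - c%:M in Rc Bu *; set X := invmx B in Rc *.
have XJ : X^t* = X.
  apply: trmxC_inv; rewrite trmxCD gram_hermitian linearN /= map_mxN.
  by rewrite trmxC_scalar // gtr0_real.
have hZ : #|[pred j | d 0 j == 0]| = (n - l)%N.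
  rewrite -[LHS](addKn l) -{1}Zd; congr (_ - _)%N.
  apply: etrans (card_ord n); rewrite -[RHS](cardC [pred j | d 0 j != 0]).
  by congr (_ + _)%N; apply: eq_card => j; rewrite !inE negbK.
rewrite -hZ in hb; have [D0 hD] := barrier_shift n0 cb hd hb.
have trb : barrier V b = \sum_j (d 0 j - b)^-1.
  rewrite /barrier Rb mxtrace_conj_diag //.
  by apply: eq_bigr => j _; rewrite mxE.
have trc : \tr X = \sum_j (d 0 j - c)^-1.
  by rewrite Rc mxtrace_conj_diag //; apply: eq_bigr => j _; rewrite mxE.
have trc2 : \tr (X *m X) = \sum_j (d 0 j - c)^-1 ^+ 2.
  rewrite Rc conj_diag_mul // mxtrace_conj_diag //.
  by apply: eq_bigr => j _; rewrite !mxE.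
rewrite -trb -trc -trc2 in D0 hD; set D := barrier V b - \tr X in D0 hD.
move=> hbar.
pose q i := ((v i)^t* *m X *m v i) 0 0; pose s i := sqnorm (X *m v i).
have sE i : s i = ((v i)^t* *m (X *m X) *m v i) 0 0.
  by rewrite /s /sqnorm trmxC_mul XJ !mulmxA.
have [i hi] : exists i, s i <= D * - (1 + q i).
  apply/existsP; apply: contraT; rewrite negb_exists => /forallP lt.
  have : \sum_i D * - (1 + q i) < \sum_i s i.
    apply: ltr_sum => [|i _].
      by apply/hasP; exists (Ordinal m0); rewrite ?mem_index_enum.
    have Dr : D * - (1 + q i) \is Num.real.
      rewrite realM ?(gtr0_real D0) // rpredN rpredD ?real1 //.
      exact: hermitian_form_real.
    by rewrite real_ltNge ?lt // ger0_real // sqnorm_ge0.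
  rewrite -mulr_sumr sumrN big_split /= sumr_const card_ord isotropic_trace.
  under [X in _ < X]eq_bigr do rewrite sE.
  rewrite isotropic_trace => /lt_le_trans/(_ hD).
  rewrite expr2 -mulrDr ltr_pM2l // le_gtF // opprD.
  have -> : \tr X = barrier V b - D by rewrite /D; ring.
  rewrite opprB [leRHS]addrCA [leLHS]addrC lerD2l.
  by rewrite lerBrDr addrC -lerBrDr.
have q_lt0 : 1 + q i < 0.
  have : 0 <= - (1 + q i).
    by rewrite -(pmulr_rge0 _ D0) (le_trans _ hi) // sqnorm_ge0.
  (* Equality would force X *m v i = 0, hence q i = 0. *)
  rewrite oppr_ge0 le_eqVlt => /orP[/eqP q0|//].
  move: hi; rewrite q0 oppr0 mulr0 => s0.
  have /eqP : s i = 0 by apply/eqP; rewrite eq_le s0 sqnorm_ge0.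
  rewrite sqnorm_eq0 => /eqP Xv.
  by move/eqP: q0; rewrite /q -mulmxA Xv mulmx0 mxE addr0 oner_eq0.
exists i; split.
  by apply: gram_gt_row_mx => //; exact: gram_gt_le (ltW cb') Vb.
rewrite {1}/barrier tr_row_mx map_col_mx mul_row_col -addrA addrC -/B.
rewrite sherman_morrison_trace ?lt_eqF //.
rewrite -/X -/(q i) lerBlDr -lerBlDl -opprB -/D ler_ndivlMr //.
by rewrite mulNr -mulrN -(mulmxA _ X X) -sE.
Qed.

End Barrier.

(** * Choosing k vectors *)

Section Selection.
Variables (C : numClosedFieldType) (n m : nat) (v : 'I_m -> 'cV[C]_n).
Hypothesis hv : \sum_(i < m) v i *m (v i)^t* = 1%:M.

Definition columns l (f : 'I_l -> 'I_m) : 'M[C]_(n, l) :=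
  \matrix_(i, j) v (f j) i 0.

(** The two inequalities on [b] and [e] make every step possible: the first is
    equivalent to [b - l e <= (n - l) e], which is what step [l] needs, and the
    second bounds the initial potential [- n / b]. *)
Lemma barrier_selection (b e : C) (k : nat) :
  0 < e -> 0 < b - k%:R * e -> b <= n%:R * e -> m%:R + e^-1 <= n%:R / b ->
  exists f : 'I_k -> 'I_m, gram_gt (columns f) (b - k%:R * e).
Proof.
move=> e0 bk0 bn mb.
suff [f []] : exists f : 'I_k -> 'I_m, gram_gt (columns f) (b - k%:R * e) /\
    barrier (columns f) (b - k%:R * e) <= - m%:R - e^-1 by exists f.
elim: k bk0 => [|l IHl] bk0.
  have f : 'I_0 -> 'I_m by case.
  rewrite mul0r subr0 in bk0 *; exists f; split.
    by move=> x; rewrite (flatmx0 x) eqxx.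
  rewrite /barrier (flatmx0 (_ ^t*)) mulmx0 sub0r -scalemx1 -scaleNr scalemx1.
  rewrite invmx_scalar mxtrace_scalar -opprD invrN mulNrn lerN2.
  by rewrite -[leRHS]mulr_natl.
have be : b - l.+1%:R * e = b - l%:R * e - e.
  by rewrite -addn1 natrD mulrDl mul1r opprD addrA.
have bl : 0 < b - l.+1%:R * e < b - l%:R * e.
  by rewrite bk0 be gtrBl.
have bl0 : 0 < b - l%:R * e by case/andP: bl; exact: lt_trans.
have [f [Vf Bf]] := IHl bl0.
have eE : b - l%:R * e - (b - l.+1%:R * e) = e by rewrite be opprB addrC subrK.
have [||i [Vi Bi]] := barrier_step hv bl Vf; rewrite ?eE //.
  have [ln|nl] := leqP l n; first by rewrite natrB // mulrBl lerB.
  have : 0 < (n%:R - l%:R) * e.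
    by rewrite mulrBl (lt_le_trans bl0) // lerB.
  by rewrite pmulr_lgt0 // subr_gt0 ltr_nat ltnNge (ltnW nl).
pose g (j : 'I_l.+1) := if unlift ord0 j is Some j' then f j' else i.
have gE : row_mx (v i) (columns f) = columns g.
  apply/matrixP => a j; rewrite !mxE /g.
  case: splitP => [j0 jj0|j' jj'].
    have -> : j = ord0 by apply/val_inj; rewrite /= jj0 ord1.
    by rewrite unlift_none ord1.
  have -> : j = lift ord0 j' by apply/val_inj; rewrite /= jj'.
  by rewrite liftK mxE.
by exists g; rewrite gE in Vi Bi; split; [exact: Vi | exact: le_trans Bi Bf].
Qed.

(** A repeated vector would give a nonzero kernel vector of [columns f]. *)
Lemma gram_gt_inj l (f : 'I_l -> 'I_m) (b : C) :
  0 <= b -> gram_gt (columns f) b -> injective f.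
Proof.
move=> b0 Vf j1 j2 f12; apply/eqP; apply: contraT => j12.
pose x : 'cV[C]_l := delta_mx j1 0 - delta_mx j2 0.
have /Vf : x != 0.
  apply/eqP => /colP/(_ j1)/eqP.
  by rewrite !mxE eqxx (negPf j12) subr0 oner_eq0.
have -> : columns f *m x = 0.
  rewrite mulmxBr -!colE; apply/colP => i.
  by rewrite !mxE f12 subrr.
have /eqP-> : sqnorm (0 : 'cV[C]_n) == 0 by rewrite sqnorm_eq0.
by rewrite le_gtF // mulr_ge0 // sqnorm_ge0.
Qed.

Lemma columns_gram l (f : 'I_l -> 'I_m) : injective f ->
  \sum_(i in f @: setT) v i *m (v i)^t* = columns f *m (columns f)^t*.
Proof.
move=> finj; rewrite big_imset /=; last by move=> ? ? _ _; exact: finj.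
apply/matrixP => i j; rewrite summxE !mxE.
rewrite (eq_bigl predT) => [|?]; last by rewrite inE.
by apply: eq_bigr => a _; rewrite !mxE big_ord1 !mxE.
Qed.

End Selection.

(** * From the Gram bound to the k-th eigenvalue *)

Lemma char_poly_conj (F : fieldType) n (P A : 'M[F]_n) : P \in unitmx ->
  char_poly (invmx P *m A *m P) = char_poly A.
Proof.
move=> Pu; rewrite /char_poly.
pose Q := map_mx polyC P; pose Q' := map_mx polyC (invmx P).
have QQ : Q' *m Q = 1%:M by rewrite -map_mxM mulVmx // map_mx1.
have -> : char_poly_mx (invmx P *m A *m P) = Q' *m char_poly_mx A *m Q.
  rewrite /char_poly_mx mulmxBr mulmxBl !map_mxM; congr (_ - _).
  by rewrite mul_mx_scalar -scalemxAl QQ scalemx1.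
by rewrite !det_mulmx mulrAC -det_mulmx QQ det1 mul1r.
Qed.

Section Lambda.
Variable R : realType.
Local Open Scope complex_scope.

(** Exactly [l] eigenvalues of [V V^*] exceed [b], so the [l]-th of the
    decreasing list does. *)
Lemma lambda_gram n l (V : 'M[R[i]]_(n, l)) (b : R) :
  (0 < l)%N -> 0 <= b -> gram_gt V b%:C -> b <= lambda_ l (V *m V^t*).
Proof.
move=> l0 b0 Vb; have b0C : 0 <= b%:C :> R[i] by rewrite lecR.
have [P Pu [d [Ad hd Zd]]] := gram_spectrum b0C Vb.
set A := V *m _ in Ad *.
have ceig : perm_eq (complex_eigenvalues A) [seq d 0 j | j <- enum 'I_n].
  apply: prod_XsubC_eq; rewrite -char_poly_complex_eigenvalues Ad.
  rewrite char_poly_conj //.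
  rewrite char_poly_trig ?diag_mx_is_trig // big_map big_enum /=.
  by apply: eq_bigr => j _; rewrite mxE eqxx.
have cnt : count (> b) (eigenvalues A) = l.
  rewrite count_sort count_map (permP ceig) count_map.
  rewrite -Zd cardE -size_filter enumT /enum_mem; congr size.
  apply: eq_filter => j; rewrite !inE /=; case: (hd j) => [->|bd].
    by rewrite eqxx; apply: le_gtF.
  rewrite (gt_eqF (le_lt_trans b0C bd)).
  by move: bd; rewrite ltcE => /andP[].
rewrite /lambda_ leNgt; apply/negP => lt.
set s := eigenvalues A in cnt lt.
have : (count (> b) s <= l.-1)%N.
  rewrite -(cat_take_drop l.-1 s) count_cat.
  rewrite [X in (_ + X)%N](_ : _ = 0%N); last first.
    apply/eqP; rewrite eqn0Ngt -has_count; apply/hasPn => x xs.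
    have [i + <-] := elimT (nthP 0) xs.
    rewrite size_drop ltn_subRL nth_drop => hi /=.
    rewrite -leNgt (le_trans _ (ltW lt)) //.
    have := sorted_leq_nth ge_trans ge_refl 0 (eigenvalues_sorted A).
    apply; rewrite ?inE ?leq_addr //.
    by apply: leq_ltn_trans hi; exact: leq_addr.
  rewrite addn0 (leq_trans (count_size _ _)) // size_take; case: ltnP => //.
by rewrite cnt -ltnS prednK // ltnn.
Qed.

End Lambda.

Theorem theorem3p1 (R : realType) (n m : nat) (v : 'I_m -> 'cV[R[i]]_n)
    (hv : \sum_(i < m) v i *m (v i)^t* = 1%:M)
    (k : nat) (hk1 : (1 <= k)%N) (hkn : (k < n)%N) :
  exists S : {set 'I_m}, #|S| = k /\
    (1 - Num.sqrt (k%:R / n%:R)) ^+ 2 * (n%:R / m%:R)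
      <= lambda_ k (\sum_(i in S) v i *m (v i)^t*).
Proof.
set s := Num.sqrt _.
have n0 : 0 < n%:R :> R by rewrite ltr0n (leq_ltn_trans _ hkn).
have k0 : 0 < k%:R :> R by rewrite ltr0n.
have m0 : 0 < m%:R :> R.
  rewrite ltr0n; case: m v hv => // v0; rewrite big_ord0 => /matrixP.
  have n0' : (0 < n)%N by exact: leq_ltn_trans hkn.
  move=> /(_ (Ordinal n0') (Ordinal n0'))/eqP.
  by rewrite !mxE eqxx eq_sym oner_eq0.
have s0 : 0 < s by rewrite sqrtr_gt0 divr_gt0.
have s1 : s < 1.
  by rewrite -sqrtr1 ltr_sqrt // ltr_pdivrMr // mul1r ltr_nat.
have kE : k%:R = n%:R * s ^+ 2.
  by rewrite sqr_sqrtr ?divr_ge0 ?ltW // mulrC divfK // gt_eqF.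
pose b := (1 - s) * (n%:R / m%:R); pose e := (1 - s) / (s * m%:R).
have s1' : 0 < 1 - s by rewrite subr_gt0.
have bE : b - k%:R * e = (1 - s) ^+ 2 * (n%:R / m%:R).
  by rewrite /b /e kE; field; rewrite !gt_eqF.
have bk0 : 0 < b - k%:R * e.
  by rewrite bE mulr_gt0 ?exprn_gt0 ?divr_gt0.
have e0 : 0 < e by rewrite divr_gt0 ?mulr_gt0.
have bn : b <= n%:R * e.
  have -> : n%:R * e = b / s by rewrite /b /e; field; rewrite !gt_eqF.
  by rewrite ler_pdivlMr // ler_piMr ?ltW // mulr_gt0 ?divr_gt0.
have mb : m%:R + e^-1 = n%:R / b.
  by rewrite /b /e; field; rewrite !gt_eqF.
have cE : ((b - k%:R * e)%:C = b%:C - k%:R * e%:C)%C.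
  rewrite (rmorphB (real_complex R)) (rmorphM (real_complex R) k%:R e).
  by rewrite rmorph_nat.
have [||||f Vf] := barrier_selection hv (b := b%:C%C) (e := e%:C%C) (k := k).
- by rewrite ltcR.
- by rewrite -cE ltcR.
- by rewrite -(rmorph_nat (real_complex R)) -rmorphM lecR.
- rewrite -!(rmorph_nat (real_complex R)) -!fmorphV -rmorphM -rmorphD lecR.
  by rewrite mb.
rewrite -cE in Vf; have bk0' := ltW bk0.
have finj : injective f by apply: gram_gt_inj Vf; rewrite lecR.
exists (f @: setT); split; first by rewrite card_imset // cardsT card_ord.
by rewrite columns_gram // -bE; apply: lambda_gram.
Qed.
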